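(* Let $\alpha\in(0,1)$ be irrational, let $\mathbf a$ be the Sturmian word with slope $\alpha$ and intercept $0$, and let $m,n\ge1$ be integers. Then the $m\times n$ rectangles of $\mathbf a$ are balanced if and only if the intervals of length $\{n\alpha\}$ are balanced with respect to $(\alpha,m)$.
   Context: The Sturmian word with slope $\alpha$ and intercept $\theta$ is $a_j=\lfloor (j+1)\alpha+\theta\rfloor-\lfloor j\alpha+\theta\rfloor$, $j\ge1$. For $i\ge1$ let $T(i,m,n)=\sum_{k=0}^{m-1}\sum_{\ell=0}^{n-1}a_{i+k+\ell}$; the $m\times n$ rectangles are balanced if there is an integer $c$ with $T(i,m,n)\in\{c,c+1\}$ for all $i\ge1$. For $d\in(0,1)$ and an integer $N\ge1$, the intervals of length $d$ are balanced with respect to $(\alpha,N)$ if there is an integer $c$ such that for every $x\in[0,1)$, $\#\{k:0\le k\le N-1,\ \{k\alpha\}\in[x,x+d)\}\in\{c,c+1\}$, where $\{y\}=y-\lfloor y\rfloor$ and the interval is taken modulo $1$ (if $x+d\ge1$ it means $[x,1)\cup[0,\{x+d\})$). *)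

(* Defs.v *)
From HB Require Import structures.
From mathcomp Require Import all_boot all_order all_algebra.
From mathcomp Require Import reals.

Set Implicit Arguments.
Unset Strict Implicit.
Unset Printing Implicit Defensive.

Import Order.TTheory GRing.Theory Num.Theory.
Local Open Scope ring_scope.

Definition fracpart (R : realType) (y : R) : R := y - (Num.floor y)%:~R.

(* The word is a_1 a_2 ...; the value at j = 0 is never used below. *)
Definition sturmian (R : realType) (alpha theta : R) (j : nat) : int :=
  Num.floor (j.+1%:R * alpha + theta) - Num.floor (j%:R * alpha + theta).

Definition rectangle_sum (a : nat -> int) (i m n : nat) : int :=
  \sum_(k < m) \sum_(l < n) a (i + k + l)%N.

Definition rectangles_balanced (a : nat -> int) (m n : nat) : Prop :=
  exists c : int, forall i : nat, (1 <= i)%N ->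
    rectangle_sum a i m n = c \/ rectangle_sum a i m n = c + 1.

(* [x, x + d) modulo 1, for 0 <= x < 1 and 0 < d < 1. *)
Definition in_circle_interval (R : realType) (x d y : R) : bool :=
  if x + d < 1 then y \in `[x, x + d[
  else (y \in `[x, 1[) || (y \in `[0, fracpart (x + d)[).

Definition interval_count (R : realType) (alpha : R) (N : nat) (x d : R) : nat :=
  #|[set k : 'I_N | in_circle_interval x d (fracpart (k%:R * alpha))]|.

Definition intervals_balanced (R : realType) (d alpha : R) (N : nat) : Prop :=
  exists c : int, forall x : R, 0 <= x < 1 ->
    (interval_count alpha N x d)%:Z = c \/
    (interval_count alpha N x d)%:Z = c + 1.

(* Main.v *)
Require Import Defs.
From HB Require Import structures.
From mathcomp Require Import all_boot all_order all_algebra.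
From mathcomp Require Import reals.
From mathcomp Require Import ring lra zify.

Import Order.TTheory GRing.Theory Num.Theory.
Local Open Scope ring_scope.

(** The indicator of [{y} \in [x, x + d)] modulo 1 equals
    [floor (y - x) - floor (y - x - d)], so the interval count is a function
    [G x] that is 1-periodic and defined for every real [x].  The inner sums of
    a rectangle telescope, and with [d = {n alpha}] this gives
    [T(i, m, n) = m * floor (n alpha) + G (- (i + n) alpha)].  Hence balanced
    intervals give balanced rectangles.  Conversely, since [floor] is right
    continuous, [G] is constant on some [(x - e, x]], and the orbit
    [- (i + n) alpha], [i >= 1], meets that interval modulo 1 by density. *)

Section Floor.
Context {R : realType}.
Implicit Types (x y d e u : R).

Lemma floorDz x (p : int) : Num.floor (x + p%:~R) = Num.floor x + p.
Proof. by rewrite floorDrz ?intr_int// intrKfloor. Qed.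

Lemma fracpart_itv y : 0 <= fracpart y < 1.
Proof.
by have := floor_itv y; rewrite /fracpart intrD => /andP[? ?]; apply/andP; lra.
Qed.

(** The right side counts the integers [p] with [y - x - d < p <= y - x], that is
    [x <= y - p < x + d]; as [d < 1] there is at most one. *)
Lemma in_circle_intervalE x d y : 0 <= x < 1 -> 0 <= d < 1 ->
  (in_circle_interval x d (fracpart y))%:Z =
  Num.floor (y - x) - Num.floor (y - x - d).
Proof.
move=> /andP[x0 x1] /andP[d0 d1].
have /andP[f0 f1] := fracpart_itv y.
have yE : y = fracpart y + (Num.floor y)%:~R by rewrite /fracpart subrK.
(* The integer part [F] shifts both floors equally and cancels, leaving finitely many cases for [f]
   in [[0, 1)]. *)
rewrite {2 3}yE; move: (fracpart y) (Num.floor y) f0 f1 => f F f0 f1.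
have -> : f + F%:~R - x = (f - x) + F%:~R by ring.
have -> : f - x + F%:~R - d = (f - x - d) + F%:~R by ring.
rewrite !floorDz.
have floorE (z : R) (p : int) : p%:~R <= z < p%:~R + 1 -> Num.floor z = p :> int.
  by move=> h; apply: floor_def; rewrite intrD.
have -> : Num.floor (f - x) = if x <= f then 0 else -1.
  by case: (leP x f) => h; apply: floorE; apply/andP; split; lra.
have -> : Num.floor (f - x - d) =
    if x + d <= f then 0 else if x + d - 1 <= f then -1 else -2.
  case: (leP (x + d) f) => h; first by apply: floorE; apply/andP; split; lra.
  by case: (leP (x + d - 1) f) => h'; apply: floorE; apply/andP; split; lra.
rewrite /in_circle_interval; case: ltP => xd.
  rewrite in_itv/=.
  case: (leP x f) => ?; case: (leP (x + d) f) => ?;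
    by case: (leP (x + d - 1) f) => ? /=; try lia; exfalso; lra.
have -> : fracpart (x + d) = x + d - 1.
  by rewrite /fracpart (floorE _ 1)//; apply/andP; split; lra.
rewrite !in_itv/= f0 f1 /= andbT.
case: (leP x f) => ?; case: (leP (x + d) f) => ?;
  by case: (leP (x + d - 1) f) => ? /=; try lia; exfalso; lra.
Qed.

Lemma floor_right_constant (s : seq R) : exists2 e, 0 < e &
  forall u t, u \in s -> 0 <= t < e -> Num.floor (u + t) = Num.floor u.
Proof.
elim: s => [|u s [e e0 IH]]; first by exists 1.
have /andP[fu uf] := floor_itv u; rewrite intrD in uf.
(* The new bound is the distance from [u] to the next integer above it. *)
exists (Num.min e ((Num.floor u)%:~R + 1 - u)).
  by rewrite lt_min e0/=; lra.
move=> v t; rewrite inE lt_min => /predU1P[-> |vs] /and3P[t0 te tu].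
  by apply: floor_def; rewrite intrD; apply/andP; split; lra.
by apply: IH; rewrite ?t0.
Qed.

End Floor.

Section OrbitDensity.
Context {R : realType}.
Implicit Types (alpha y b e : R).

(** Pigeonhole: [N + 2] multiples of [alpha] fall, modulo 1, into [N + 1] boxes of length
    [1 / (N + 1) < e], so two of them share a box. *)
Lemma dirichlet_approx alpha e : 0 < e ->
  exists q (p : int), (0 < q)%N /\ `|q%:R * alpha - p%:~R| < e.
Proof.
move=> e0; pose N := (Num.truncn e^-1); pose r : R := N.+1%:R.
have r0 : 0 < r by rewrite ltr0n.
have re : r^-1 < e.
  by rewrite invf_plt ?posrE// /r truncnS_gt.
pose box (k : nat) := Num.truncn (r * fracpart (k%:R * alpha)).
have boxP k : (box k)%:R <= r * fracpart (k%:R * alpha) < (box k).+1%:R.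
  have /andP[f0 _] := fracpart_itv (k%:R * alpha).
  by rewrite truncn_itv// mulr_ge0// ltW.
have box_lt k : (box k < N.+1)%N.
  have /andP[_ f1] := fracpart_itv (k%:R * alpha).
  have /andP[h _] := boxP k.
  by rewrite -(ltr_nat R) (le_lt_trans h)// gtr_pMr.
pose g (k : 'I_N.+2) : 'I_N.+1 := Ordinal (box_lt k).
have /injectivePn[k1 [k2 k12 gE]] : ~~ injectiveb g.
  by apply/injectiveP => /leq_card; rewrite !card_ord ltnn.
wlog lt12 : k1 k2 k12 gE / (k1 < k2)%N.
  move=> H; case: (ltngtP k1 k2) => h; first exact: (H k1 k2).
    by apply: (H k2 k1) => //; rewrite eq_sym.
  by move: k12; rewrite -val_eqE/= h eqxx.
exists (k2 - k1)%N, (Num.floor (k2%:R * alpha) - Num.floor (k1%:R * alpha)).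
split; first by rewrite subn_gt0.
have bE : box k1 = box k2 by case: gE.
have /andP[l1 u1] := boxP k1; have /andP[l2 u2] := boxP k2.
rewrite -bE -!natr1 in l1 u1 l2 u2.
rewrite natrB 1?ltnW// intrB.
have -> : (k2%:R - k1%:R) * alpha -
    ((Num.floor (k2%:R * alpha))%:~R - (Num.floor (k1%:R * alpha))%:~R) =
    fracpart (k2%:R * alpha) - fracpart (k1%:R * alpha).
  by rewrite /fracpart; ring.
apply: lt_trans re; rewrite -[r^-1]mul1r ltr_pdivlMr//.
rewrite -[X in _ * X](gtr0_norm r0) -normrM mulrC mulrBr ltr_norml.
by apply/andP; split; lra.
Qed.

Lemma irrational_mul_neq_int alpha (q : nat) (p : int) :
  irrational alpha -> (0 < q)%N -> q%:R * alpha != p%:~R.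
Proof.
move=> irr q0; apply/eqP => h; apply: irr.
exists (p%:~R / q%:R) => //.
rewrite fmorph_div/= ratr_int ratr_nat -h mulrAC mulfV ?mul1r//.
by rewrite pnatr_eq0 -lt0n.
Qed.

(** Steps shorter than [e] cannot jump over a window of length [e] that starts at an integer. *)
Lemma small_multiples_hit_int y b e : b != 0 -> `|b| < e ->
  exists j (z : int), (0 < j)%N /\ z%:~R <= y + j%:R * b < z%:~R + e.
Proof.
rewrite neq_lt => /orP[b0|b0].
- rewrite ltr0_norm// => be.
  (* Taking [z] below [y + b] forces [w >= 1], hence a positive index; the index is that of the last
     point not below [z]. *)
  pose z := Num.floor (y + b) - 1.
  have zP : z%:~R < y + b.
    by have := floor_le (y + b); rewrite /z intrB; lra.
  pose w := (y - z%:~R) / - b.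
  have w1 : 1 <= w by rewrite /w ler_pdivlMr; lra.
  exists (Num.truncn w), z; split.
    by rewrite truncn_gt0.
  have /andP[] : (Num.truncn w)%:R <= w < (Num.truncn w).+1%:R.
    by apply: truncn_itv; lra.
  move: (Num.truncn w) => j; rewrite -natr1 /w.
  rewrite ler_pdivlMr ?ltr_pdivrMr ?oppr_gt0// => ? ?.
  by apply/andP; split; lra.
- rewrite gtr0_norm// => be.
  (* Here the walk goes up, and the index is that of the first point at or above [z]. *)
  pose z := Num.floor (y + b) + 1.
  have zP : y + b < z%:~R by rewrite /z floorD1_gt.
  pose w := (z%:~R - y) / b.
  have w1 : 1 < w by rewrite /w ltr_pdivlMr; lra.
  have /andP[cl cu] := ceil_itv w; rewrite intrB in cl.
  have c0 : (0 < Num.ceil w)%R by rewrite ceil_gt0; lra.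
  have cE : (`|Num.ceil w|%N)%:R = (Num.ceil w)%:~R :> R.
    by rewrite natr_absz gtr0_norm.
  exists `|Num.ceil w|%N, z; split; first by rewrite absz_gt0 gt_eqF.
  rewrite cE; move: cl cu; rewrite ltrBlDr -ltrBlDr /w.
  rewrite ltr_pdivlMr// ler_pdivrMr// => ? ?.
  by apply/andP; split; lra.
Qed.

Lemma orbit_dense alpha y e : irrational alpha -> 0 < e ->
  exists i (z : int), (0 < i)%N /\ z%:~R <= y + i%:R * alpha < z%:~R + e.
Proof.
move=> irr e0; have [q [p [q0 qp]]] := dirichlet_approx alpha _ e0.
have b0 : q%:R * alpha - p%:~R != 0.
  by rewrite subr_eq0 irrational_mul_neq_int.
have [j [z [j0 jz]]] := small_multiples_hit_int y _ _ b0 qp.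
(* With [b = q alpha - p], one has [j q alpha = j b + j p], so the target integer moves by [j p]. *)
exists (j * q)%N, (z + p *+ j); split; first by rewrite muln_gt0 j0.
rewrite natrM intrD rmorphMn/= -mulr_natl; case/andP: jz => ? ?.
by apply/andP; split; lra.
Qed.

End OrbitDensity.

Section Counting.
Context {R : realType}.
Variable alpha : R.
Implicit Types (x d : R).

Definition floor_count (N : nat) x d : int :=
  \sum_(k < N) (Num.floor (k%:R * alpha - x) - Num.floor (k%:R * alpha - x - d)).

Lemma interval_countE N x d : 0 <= x < 1 -> 0 <= d < 1 ->
  (interval_count alpha N x d)%:Z = floor_count N x d.
Proof.
move=> x01 d01; rewrite /interval_count -sum1dep_card -natz natr_sum.
rewrite big_mkcond/=; apply: eq_bigr => k _.
by rewrite -in_circle_intervalE//; case: in_circle_interval.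
Qed.

Lemma floor_countDz N x d (p : int) :
  floor_count N (x + p%:~R) d = floor_count N x d.
Proof.
apply: eq_bigr => k _.
have -> : k%:R * alpha - (x + p%:~R) = k%:R * alpha - x + (- p)%:~R.
  by rewrite intrN; ring.
have -> : k%:R * alpha - x + (- p)%:~R - d = k%:R * alpha - x - d + (- p)%:~R.
  by ring.
by rewrite !floorDz; ring.
Qed.

(** Moving [x] to the left moves the arguments of the [2 N] floors to the right. *)
Lemma floor_count_left_constant N x d : exists2 e, 0 < e &
  forall t, 0 <= t < e -> floor_count N (x - t) d = floor_count N x d.
Proof.
pose u (k : nat) := k%:R * alpha - x; pose v k := u k - d.
have [e e0 eP] := floor_right_constant (map u (iota 0 N) ++ map v (iota 0 N)).
exists e => // t t0e; apply: eq_bigr => k _.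
have kN : (k : nat) \in iota 0 N by rewrite mem_iota/= add0n.
have -> : k%:R * alpha - (x - t) = u k + t by rewrite /u; ring.
have -> : u k + t - d = v k + t by rewrite /v; ring.
by rewrite (eP (u k)) 1?(eP (v k)) // mem_cat ?(map_f v) ?(map_f u) ?orbT.
Qed.

Lemma rectangle_sum_sturmian i m n :
  rectangle_sum (sturmian alpha 0) i m n =
  Num.floor (n%:R * alpha) *+ m +
  floor_count m (- (i + n)%:R * alpha) (fracpart (n%:R * alpha)).
Proof.
rewrite /rectangle_sum /floor_count -[in X in _ *+ X](card_ord m) -sumr_const.
rewrite -big_split/=; apply: eq_bigr => k _.
pose f l := Num.floor ((i + k + l)%:R * alpha).
rewrite (eq_bigr (fun l : 'I_n => f l.+1 - f l)); last first.
  by move=> l _; rewrite /sturmian /f !addr0 addnS.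
rewrite -(big_mkord xpredT (fun l => f l.+1 - f l)) telescope_sumr// /f.
have -> : k%:R * alpha - - (i + n)%:R * alpha = (i + k + n)%:R * alpha.
  by rewrite !natrD; ring.
(* Since [n alpha - {n alpha}] is an integer, the lower end of the telescoped sum appears up to that
   integer, once for each [k]. *)
have -> : (i + k + n)%:R * alpha - fracpart (n%:R * alpha) =
    (i + k + 0)%:R * alpha + (Num.floor (n%:R * alpha))%:~R.
  by rewrite /fracpart addn0 !natrD; ring.
by rewrite floorDz; ring.
Qed.

End Counting.

Theorem theorem3p1 (R : realType) (alpha : R)
    (alpha01 : 0 < alpha < 1) (alpha_irr : irrational alpha)
    (m n : nat) (m_ge1 : (1 <= m)%N) (n_ge1 : (1 <= n)%N) :
  rectangles_balanced (sturmian alpha 0) m n <->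
  intervals_balanced (fracpart (n%:R * alpha)) alpha m.
Proof.
have d01 := fracpart_itv (n%:R * alpha).
set d := fracpart _ in d01 *.
split=> -[c cP].
- exists (c - Num.floor (n%:R * alpha) *+ m) => x x01; rewrite interval_countE//.
  have [e e0 eP] := floor_count_left_constant alpha m x d.
  (* Density is applied at [x + n alpha] so that the offset [t = x + (i + n) alpha - z] lies in
     [[0, e)]; then [x - t] is [- (i + n) alpha] modulo 1. *)
  have [i [z [i0 /andP[zi iz]]]] :=
    orbit_dense alpha (x + n%:R * alpha) _ alpha_irr e0.
  have := cP i i0; rewrite rectangle_sum_sturmian -/d.
  rewrite -(floor_countDz _ _ _ _ z).
  rewrite -(eP (x + n%:R * alpha + i%:R * alpha - z%:~R)); last first.
    by apply/andP; split; lra.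
  have -> : x - (x + n%:R * alpha + i%:R * alpha - z%:~R) =
     - (i + n)%:R * alpha + z%:~R by rewrite natrD; ring.
  by move: (floor_count _ _ _ _) (_ *+ m) => u v; lia.
- exists (Num.floor (n%:R * alpha) *+ m + c) => i _.
  rewrite rectangle_sum_sturmian -/d.
  (* The hypothesis covers only [[0, 1)], so [y] is reduced modulo 1 and periodicity restores it. *)
  set y := - _ * _; have := cP (fracpart y) (fracpart_itv y).
  rewrite interval_countE ?fracpart_itv//.
  rewrite -(floor_countDz _ _ _ _ (Num.floor y)) subrK.
  by move: (floor_count _ _ _ _) (_ *+ m) => u v; lia.
Qed.
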